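(* Let $A=KQ/I$ be a gentle algebra with basis of paths $\mathcal{B}$. The (classes of the) following elements $(a,q)\in K(Q_1\|\mathcal{B})$ give a basis of $HH^1(A)$: (1) $(a,q)$ such that $a$ does not appear in $q$ and $a$ is not in any relation in $I$ ($a$ is then called a shortcut for $q$); (2) $(a,q)$ such that $q=q_2aq_1$ with $q_1,q_2\notin Q_0$ and $a$ is not in any relation in $I$ ($q$ is then called a deviation via $a$); (3) $(a,a)$, where exactly one arrow $a$ is chosen in each fundamental cycle in $Q$; (4) if $\operatorname{char}K=2$, in addition to the elements $(a,q)$ with $a$ a shortcut for $q$, the elements $(a,q)$ with $q$ a deviation via $a$, and the elements $(a,a)$ for the arrows $a$ chosen in the fundamental cycles, also the elements $(a,s(a))$ such that $a$ is a loop.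
   Context: $K$ is a field; all algebras are finite dimensional and indecomposable. Paths in a quiver are composed right to left ($ba$ means first $a$, then $b$); $s,t$ denote source and target; vertices are identified with trivial paths. A gentle algebra is $A=KQ/I$ (finite dimensional), with $Q$ a finite connected quiver, such that: (1) at each vertex at most two arrows end and at most two arrows start; (2) for every arrow $a$ there is at most one arrow $b$ with $s(a)=t(b)$ and $ab\notin I$, and at most one arrow $c$ with $s(c)=t(a)$ and $ca\notin I$; (3) for every arrow $a$ there is at most one arrow $b$ with $s(a)=t(b)$ and $ab\in I$, and at most one arrow $c$ with $s(c)=t(a)$ and $ca\in I$; (4) $I$ is generated by paths of length $2$. Standing assumption: $A$ is neither $K$ (one vertex, no arrow) nor $K[x]/(x^2)$ (one vertex, one loop). $R$ is the minimal set of paths of length $2$ generating $I$ (the relations); $\mathcal{B}$ is the set of paths of $Q$ (including trivial ones) containing no element of $R$ as a subpath; it is a $K$-basis of $A$. Two paths are parallel if they have the same source and the same target; for sets of paths $X,Y$, $X\|Y$ is the set of pairs $(p,q)\in X\times Y$ of parallel paths, and $K(X\|Y)$ is the vector space with basis $X\|Y$. For a path $p$ and $(a,q)\in Q_1\|\mathcal{B}$, $p^{(a,q)}$ is the sum of all paths lying in $\mathcal{B}$ obtained by replacing exactly one occurrence of $a$ in $p$ by $q$ (it is $0$ if there are none). $\chi_{\mathcal{B}}$ is the indicator function of $\mathcal{B}$. $HH^1(A)$ is identified with $\operatorname{Ker}d^1/\operatorname{Im}d^0$ for the complex $0\to K(Q_0\|\mathcal{B})\xrightarrow{d^0}K(Q_1\|\mathcal{B})\xrightarrow{d^1}K(R\|\mathcal{B})$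 with $$d^0(e,p)=\sum_{a\in Q_1,\,s(a)=e}\chi_{\mathcal{B}}(ap)(a,ap)-\sum_{a\in Q_1,\,t(a)=e}\chi_{\mathcal{B}}(pa)(a,pa),\qquad d^1(a,p)=\sum_{q\in R}(q,q^{(a,p)}).$$ The class of $(a,q)$ corresponds to the class of the derivation $\varepsilon\mapsto\varepsilon^{(a,q)}$. Fundamental cycles: let $G_Q$ be the unoriented graph underlying $Q$ and fix a spanning tree $T$ of $G_Q$; each edge of $G_Q$ not in $T$ creates a cycle when added to $T$, and these are the fundamental cycles (there are $|Q_1|-|Q_0|+1$ of them). The choice of one arrow in each fundamental cycle is made so that the remaining arrows of $Q$ form a spanning tree. *)

(* Defs.v *)
From HB Require Import structures.
From mathcomp Require Import all_boot all_order all_algebra.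
Set Implicit Arguments.
Unset Strict Implicit.
Unset Printing Implicit Defensive.

Import GRing.Theory.
Local Open Scope ring_scope.
Local Open Scope quotient_scope.

Section VectQuotient.
Import VectorInternalTheory.
Variables (K : fieldType) (V : vectType K) (W : {vspace V}).

Definition vquot : Type := Quotient.quot (pred_of_vspace W).
HB.instance Definition _ := GRing.Zmodule.on vquot.

Definition vquot_pi (x : V) : vquot := \pi_(Quotient.quot (pred_of_vspace W)) x.
Definition vquot_repr (x : vquot) : V :=
  repr (x : Quotient.quot (pred_of_vspace W)).

Lemma vquot_reprK : cancel vquot_repr vquot_pi.
Proof. exact: reprK. Qed.

Lemma vquot_piE x y : (vquot_pi x == vquot_pi y) = (x - y \in W).
Proof. by rewrite /vquot_pi -Quotient.idealrBE. Qed.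

Lemma vquot_piD : {morph vquot_pi : x y / x + y}.
Proof. by move=> x y; apply: (raddfD (\pi_(Quotient.quot (pred_of_vspace W)))). Qed.

Definition vquot_scale (a : K) (x : vquot) : vquot :=
  vquot_pi (a *: vquot_repr x).

Lemma vquot_piZ a x : vquot_pi (a *: x) = vquot_scale a (vquot_pi x).
Proof.
apply/eqP; rewrite vquot_piE -scalerBr rpredZ // -vquot_piE.
by rewrite vquot_reprK.
Qed.

Lemma vquot_scaleA a b x : vquot_scale a (vquot_scale b x) = vquot_scale (a * b) x.
Proof. by rewrite -[x]vquot_reprK -!vquot_piZ scalerA. Qed.

Lemma vquot_scale1 : left_id 1 vquot_scale.
Proof. by move=> x; rewrite -[x]vquot_reprK -vquot_piZ scale1r. Qed.

Lemma vquot_scaleDr : right_distributive vquot_scale +%R.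
Proof.
move=> a x y; rewrite -[x]vquot_reprK -[y]vquot_reprK.
by rewrite -!(vquot_piZ, vquot_piD) scalerDr.
Qed.

Lemma vquot_scaleDl x : {morph vquot_scale^~ x : a b / a + b}.
Proof.
by move=> a b; rewrite -[x]vquot_reprK -!(vquot_piZ, vquot_piD) scalerDl.
Qed.

HB.instance Definition _ := GRing.Zmodule_isLmodule.Build K vquot
  vquot_scaleA vquot_scale1 vquot_scaleDr vquot_scaleDl.

Lemma vquot_pi_is_linear : linear vquot_pi.
Proof. by move=> a x y; rewrite vquot_piD vquot_piZ. Qed.

HB.instance Definition _ := GRing.isSemilinear.Build K V vquot _ vquot_pi
  (GRing.semilinear_linear vquot_pi_is_linear).

Lemma vquot_pi_eq0 x : (vquot_pi x == 0) = (x \in W).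
Proof. by rewrite -(linear0 vquot_pi) vquot_piE subr0. Qed.

Fact vquot_vect_axiom : Vector.axiom (dim (subvs_of W^C)) vquot.
Proof.
have dWC : (W^C :&: W = 0)%VS by rewrite capvC capv_compl.
have fullWC x : x \in (W^C + W)%VS by rewrite addvC addv_complf memvf.
have pi_proj x : vquot_pi (daddv_pi W^C W x) = vquot_pi x.
  apply/eqP; rewrite vquot_piE -{2}(daddv_pi_add dWC (fullWC x)).
  by rewrite opprD addNKr rpredN memv_pi.
have projW x : x \in W -> daddv_pi W^C W x = 0.
  move=> xW; apply/(addIr (daddv_pi W W^C x)).
  rewrite daddv_pi_add // add0r daddv_pi_id //.
  by rewrite capvC.
pose f (x : vquot) := v2r (vsproj W^C (daddv_pi W^C W (vquot_repr x))).
have f_pi x : f (vquot_pi x) = v2r (vsproj W^C (daddv_pi W^C W x)).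
  suff E : daddv_pi W^C W (vquot_repr (vquot_pi x)) = daddv_pi W^C W x.
    by rewrite /f E.
  apply/eqP; rewrite -subr_eq0 -linearB /= projW //.
  by rewrite -vquot_piE vquot_reprK.
exists f.
  move=> a x y; rewrite -[x]vquot_reprK -[y]vquot_reprK.
  have <- := vquot_pi_is_linear a (vquot_repr x) (vquot_repr y).
  by rewrite !f_pi !linearP.
exists (fun v => vquot_pi (vsval (r2v v : subvs_of W^C))) => [x|v].
  by rewrite /f v2rK vsprojK ?memv_pi // pi_proj vquot_reprK.
rewrite f_pi daddv_pi_id ?subvsP // vsvalK.
exact: r2vK.
Qed.

HB.instance Definition _ := Lmodule_hasFinDim.Build K vquot vquot_vect_axiom.

End VectQuotient.

Section FreeSpace.
Variables (K : fieldType) (I : finType).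

Definition lin_ext (V : vectType K) (b : I -> V) (f : {ffun I -> K^o}) : V :=
  \sum_i (f i : K) *: b i.

Lemma lin_ext_is_linear (V : vectType K) (b : I -> V) : linear (lin_ext b).
Proof.
move=> a f g; rewrite /lin_ext scaler_sumr -big_split /=.
by apply: eq_bigr => i _; rewrite !ffunE scalerDl scalerA.
Qed.

HB.instance Definition _ (V : vectType K) (b : I -> V) :=
  GRing.isSemilinear.Build K {ffun I -> K^o} V _ (lin_ext b)
    (GRing.semilinear_linear (lin_ext_is_linear b)).

Definition basis_vec (i : I) : {ffun I -> K^o} := [ffun j => (j == i)%:R].

End FreeSpace.

Record quiver := Quiver {
  vert : finType;
  arr : finType;
  src : arr -> vert;
  tgt : arr -> vert
}.

Section Paths.
Variable Q : quiver.

(* A path is a source vertex together with a word of arrows, written as in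
   composition from right to left: the head of the word is the last arrow. *)
Definition rawpath : Type := (vert Q * seq (arr Q))%type.
HB.instance Definition _ := Countable.on rawpath.

Definition raw_tgt (p : rawpath) : vert Q :=
  if p.2 is a :: _ then tgt a else p.1.

Fixpoint is_path (e : vert Q) (w : seq (arr Q)) : bool :=
  if w is a :: w' then (src a == raw_tgt (e, w')) && is_path e w' else true.

Record qpath := QPath {
  raw :> rawpath;
  _ : is_path raw.1 raw.2
}.
HB.instance Definition _ := [isSub for raw].
HB.instance Definition _ := [Countable of qpath by <:].

Definition psrc (p : qpath) : vert Q := (raw p).1.
Definition ptgt (p : qpath) : vert Q := raw_tgt p.
Definition word (p : qpath) : seq (arr Q) := (raw p).2.

(* [(a, true)] traverses the edge [a] from [src a]
   to [tgt a], and [(a, false)] traverses it backwards. *)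
Definition dstart (x : arr Q * bool) := if x.2 then src x.1 else tgt x.1.
Definition dend (x : arr Q * bool) := if x.2 then tgt x.1 else src x.1.

Definition graph_cycle (w : seq (arr Q * bool)) : bool :=
  [&& w != [::], cycle (fun x y => dend x == dstart y) w,
      uniq (map fst w) & uniq (map dstart w)].

Definition adjacent (T : {set arr Q}) : rel (vert Q) := fun x y =>
  [exists a in T, ((src a == x) && (tgt a == y))
               || ((src a == y) && (tgt a == x))].

Definition connected_by (T : {set arr Q}) : Prop :=
  forall x y, connect (adjacent T) x y.

Definition spanning_tree (T : {set arr Q}) : Prop :=
  connected_by T
  /\ forall w, graph_cycle w -> ~ {subset map fst w <= T}.

Definition fundamental_cycle (T : {set arr Q}) (e : arr Q)
    (w : seq (arr Q * bool)) : Prop :=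
  [/\ e \notin T, graph_cycle w & {subset map fst w <= e |: T}].

Definition chosen_arrows (T : {set arr Q}) (c : arr Q -> arr Q) : {set arr Q} :=
  [set c e | e in ~: T].

Definition fundamental_choice (T : {set arr Q}) (c : arr Q -> arr Q) : Prop :=
  (forall e, e \notin T ->
     exists2 w, fundamental_cycle T e w & c e \in map fst w)
  /\ spanning_tree (~: chosen_arrows T c).

(* [(b, a) \in R] means that the path [ba] is one of the relations.  As [I] is
   generated by [R], a path of length 2 lies in [I] iff it lies in [R]. *)
Variable R : {set arr Q * arr Q}.

Definition avoids_rel (w : seq (arr Q)) : bool :=
  sorted (fun b a => (b, a) \notin R) w.

Definition in_relation (a : arr Q) : bool :=
  [exists r in R, (r.1 == a) || (r.2 == a)].

(* [B] lists the paths avoiding [R]; its existence as a finite sequence says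
   that the algebra is finite dimensional. *)
Record gentle (B : seq qpath) : Prop := Gentle {
  gentle_basis : forall p, (p \in B) = avoids_rel (word p);
  gentle_nonempty : (0 < #|vert Q|)%N;
  gentle_connected : connected_by [set: arr Q];
  gentle_rel_path : forall r, r \in R -> src r.1 = tgt r.2;
  gentle_in : forall v : vert Q, (#|[set a : arr Q | tgt a == v]| <= 2)%N;
  gentle_out : forall v : vert Q, (#|[set a : arr Q | src a == v]| <= 2)%N;
  gentle_nonrel_before : forall a : arr Q,
    (#|[set b : arr Q | (src a == tgt b) && ((a, b) \notin R)]| <= 1)%N;
  gentle_nonrel_after : forall a : arr Q,
    (#|[set c : arr Q | (src c == tgt a) && ((c, a) \notin R)]| <= 1)%N;
  gentle_rel_before : forall a : arr Q,
    (#|[set b : arr Q | (src a == tgt b) && ((a, b) \in R)]| <= 1)%N;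
  gentle_rel_after : forall a : arr Q,
    (#|[set c : arr Q | (src c == tgt a) && ((c, a) \in R)]| <= 1)%N
}.

End Paths.

(* Finite dimensionality forces the relation [x ^ 2] on the single loop. *)
Definition is_base_field (Q : quiver) : Prop := #|vert Q| = 1%N /\ #|arr Q| = 0%N.
Definition is_dual_numbers (Q : quiver) : Prop :=
  #|vert Q| = 1%N /\ #|arr Q| = 1%N.

Section Hochschild.
Variables (K : fieldType) (Q : quiver) (R : {set arr Q * arr Q}).
Variable B : seq (qpath Q).

(* The set X || B, for a finite set X with source and target maps. *)
Definition par (X : finType) (sX tX : X -> vert Q) : predArgType :=
  {x : X * seq_sub B | (sX x.1 == psrc (val x.2)) && (tX x.1 == ptgt (val x.2))}.
HB.instance Definition _ (X : finType) (sX tX : X -> vert Q) :=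
  Finite.on (par sX tX).

Definition rel_path : predArgType := {r : arr Q * arr Q | r \in R}.
HB.instance Definition _ := Finite.on rel_path.

Definition par0 := par (fun e : vert Q => e) (fun e => e).
Definition par1 := par (@src Q) (@tgt Q).
Definition par2 :=
  par (fun r : rel_path => src (val r).2) (fun r : rel_path => tgt (val r).1).

Definition C0 := {ffun par0 -> K^o}.
Definition C1 := {ffun par1 -> K^o}.
Definition C2 := {ffun par2 -> K^o}.
HB.instance Definition _ := Vector.on C0.
HB.instance Definition _ := Vector.on C1.
HB.instance Definition _ := Vector.on C2.

Definition fst_par (X : finType) (sX tX : X -> vert Q) (x : par sX tX) : X := (val x).1.
Definition snd_par (X : finType) (sX tX : X -> vert Q) (x : par sX tX) : qpath Q := val (val x).2.

(* The basis vector (x, p) of K(X || B); it is 0 when [p] is not in [B]. *)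
Definition pvec (X : finType) (sX tX : X -> vert Q) (x : X) (p : rawpath Q) : {ffun par sX tX -> K^o} :=
  [ffun y => ((fst_par y == x) && (raw (snd_par y) == p))%:R].

Definition d0_basis (x : par0) : C1 :=
  let e := fst_par x in let p := snd_par x in
  \sum_(a | src a == e) pvec _ _ a (psrc p, a :: word p)
  - \sum_(a | tgt a == e) pvec _ _ a (src a, rcons (word p) a).

(* Replacing the arrow at position [i] of [ba] by a parallel path [p] changes
   neither the source nor the target, even when [p] is trivial. *)
Definition d1_basis (x : par1) : C2 :=
  let a := fst_par x in let p := snd_par x in
  \sum_(r : rel_path)
    let q := [:: (val r).1; (val r).2] in
    \sum_(i < 2 | nth a q i == a)
      pvec _ _ r (src (val r).2, take i q ++ word p ++ drop i.+1 q).

Definition d0 : 'Hom(C0, C1) := linfun (lin_ext d0_basis).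
Definition d1 : 'Hom(C1, C2) := linfun (lin_ext d1_basis).

Definition ker_d1 : {vspace C1} := lker d1.

(* Im d0, seen inside Ker d1. *)
Definition im_d0 : {vspace subvs_of ker_d1} :=
  (linfun (vsval : subvs_of ker_d1 -> C1) @^-1: limg d0)%VS.

Definition HH1 : Type := vquot im_d0.
HB.instance Definition _ := Vector.on HH1.

(* Meaningful only for [f] in [ker_d1]. *)
Definition hh1_class (f : C1) : HH1 := vquot_pi im_d0 (vsproj ker_d1 f).

Definition shortcuts : {set par1} :=
  [set x | (fst_par x \notin word (snd_par x)) && ~~ in_relation R (fst_par x)].

Definition deviations : {set par1} :=
  [set x | [exists i : 'I_(size (word (snd_par x))),
              [&& nth (fst_par x) (word (snd_par x)) i == fst_par x,
                  (0 < i)%N & (i.+1 < size (word (snd_par x)))%N]]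
           && ~~ in_relation R (fst_par x)].

Definition diagonal (S : {set arr Q}) : {set par1} :=
  [set x | (fst_par x \in S) && (word (snd_par x) == [:: fst_par x])].

(* The elements (a, s(a)); being parallel to s(a), the arrow a is a loop. *)
Definition loops : {set par1} := [set x | word (snd_par x) == [::]].

Definition hh1_family (S : {set arr Q}) : {set par1} :=
  shortcuts :|: deviations :|: diagonal S
  :|: (if 2%N \in [pchar K] then loops else set0).

End Hochschild.

(* Main.v *)
Require Import Defs.
From mathcomp Require Import all_boot all_order all_algebra.
Import GRing.Theory.
Local Open Scope ring_scope.

(** The differentials are combinatorial: [d0] of a nontrivial closed path [u] is
    [(x, xu) - (y, uy)], where [x] and [y] are the only arrows for which [xu],
    respectively [uy], is nonzero (uniqueness is the gentle condition; a term
    is absent if there is no such arrow), and for nontrivial [p] the cochain [d1 (a, p)] is the sum of [(ba, bp)] and [(ac, pc)] over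
    the at most one relation [ba] and at most one relation [ac], each term
    being dropped when it contains the relation again, that is when [p] ends,
    respectively starts, with [a].

    Finite dimension says that no cycle avoids the relations
    ([acyclic_composable]).  Hence a nonzero path contains each arrow at most
    once, a loop squares to zero, and a nontrivial closed path followed by
    itself is zero.

    Spanning.  A cocycle can be changed by a coboundary so that its
    coordinates at the pairs [(a, ua)], with [u] nontrivial, all vanish
    ([clear_last]).  The coefficients of [d1] then separate the remaining
    coordinates: if [(a, p)] occurs in such a cocycle, [p] is trivial and the
    characteristic is two, or [p = a], or no relation [ac] exists.  In the last
    case either [p = aw] and [(a, p)] is the coboundary of [w]
    ([head_coboundary]), or no relation [ba] exists either, and [(a, p)] is a
    shortcut or a deviation.  On the pairs [(a, a)] the quotient is the first
    cohomology of the underlying graph, for which the arrows outside a spanning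
    tree give a basis: a tree arrow is reached by the cut that it defines
    ([diagonal_span]).

    Independence.  Coboundaries have zero coordinates at shortcuts, deviations
    and trivial paths, because each arrow occurs once in a nonzero path.  On
    the diagonal, a coboundary that vanishes on a spanning tree comes from a
    constant function on the vertices ([family_free]). *)

Set Implicit Arguments.
Unset Strict Implicit.
Unset Printing Implicit Defensive.

(** * Arrows, walks and finite dimension *)

Lemma card_le1_eq (I : finType) (A : {set I}) x y :
  (#|A| <= 1)%N -> x \in A -> y \in A -> x = y.
Proof. by move=> /card_le1_eqP A1 Ax Ay; apply: A1. Qed.

Lemma sorted_uniq_acyclic (A : eqType) (e : rel A) (w : seq A) :
  (forall c, c != [::] -> ~ cycle e c) -> sorted e w -> uniq w.
Proof.
move=> acyc; elim: w => //= a w IH aw; rewrite IH ?(path_sorted aw) // andbT.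
apply/negP=> aw_in; case/path.splitP: aw_in aw => w1 w2.
by rewrite cat_path => /andP[c _]; apply: (acyc (a :: w1)).
Qed.

Section Combinatorics.
Variables (Q : quiver) (R : {set arr Q * arr Q}) (B : seq (qpath Q)).
Hypothesis hA : gentle R B.

(** Right-to-left composition: [ba] is a path of length two that is not a
    relation. *)
Definition composable (b a : arr Q) := (src b == tgt a) && ((b, a) \notin R).

(** The words of the nonzero paths from [s] to [t]: composability and the
    absence of relations are merged into a single [sorted] condition, so that
    the library on [sorted], [path] and [cycle] applies. *)
Definition walk (s t : vert Q) (w : seq (arr Q)) : bool :=
  sorted composable w &&
  (if w is b :: w' then (tgt b == t) && (src (last b w') == s) else s == t).

Lemma walkE s t w :
  walk s t w = [&& is_path s w, raw_tgt (s, w) == t & avoids_rel R w].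
Proof.
rewrite /walk /avoids_rel; case: w => [|b w] /=; first by rewrite andbT.
have -> : (src b == raw_tgt (s, w)) && is_path s w =
   path (fun b a => src b == tgt a) b w && (src (last b w) == s).
  by elim: w b => [|a w IH] b //=; rewrite ?andbT // IH andbA.
have -> : path composable b w = path (fun b a => src b == tgt a) b w
    && path (fun b a => (b, a) \notin R) b w.
  by elim: w b => //= a w IH b; rewrite IH /composable !andbA; congr (_ && _);
     rewrite -!andbA; congr (_ && _); rewrite andbC.
by case: (path _ b w) => //=; case: (path _ b w); rewrite ?andbF ?andbT //= andbC.
Qed.

Lemma composable_afterI a b b' : composable b a -> composable b' a -> b = b'.
Proof.
move=> /andP[ba rba] /andP[b'a rb'a].
by apply: (card_le1_eq (gentle_nonrel_after hA a)); rewrite inE ?ba ?b'a.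
Qed.

Lemma composable_beforeI a b b' : composable a b -> composable a b' -> b = b'.
Proof.
move=> /andP[ba rba] /andP[b'a rb'a].
by apply: (card_le1_eq (gentle_nonrel_before hA a)); rewrite inE ?ba ?b'a.
Qed.

Lemma rel_afterI a b b' : (b, a) \in R -> (b', a) \in R -> b = b'.
Proof.
move=> rba rb'a; apply: (card_le1_eq (gentle_rel_after hA a)); rewrite inE.
  by rewrite (gentle_rel_path hA rba) eqxx rba.
by rewrite (gentle_rel_path hA rb'a) eqxx rb'a.
Qed.

Lemma rel_beforeI a b b' : (a, b) \in R -> (a, b') \in R -> b = b'.
Proof.
move=> rba rb'a; apply: (card_le1_eq (gentle_rel_before hA a)); rewrite inE.
  by rewrite (gentle_rel_path hA rba) eqxx rba.
by rewrite (gentle_rel_path hA rb'a) eqxx rb'a.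
Qed.

Lemma walk_in_basis s t w :
  walk s t w -> {p | p \in B & psrc p = s /\ ptgt p = t /\ word p = w}.
Proof.
rewrite walkE => /and3P[pw /eqP tw aw].
by exists (@QPath Q (s, w) pw); first rewrite (gentle_basis hA).
Qed.

(** The powers of a cycle without relations would be nonzero paths of
    unbounded length, whereas the finite basis bounds the length. *)
Lemma acyclic_composable w : w != [::] -> ~ cycle composable w.
Proof.
case: w => // a w _ /= cw.
pose u n := flatten (nseq n (rcons w a)).
have path_u n : path composable a (u n).
  by elim: n => //= n IH; rewrite cat_path cw last_rcons.
have size_u n : (n <= size (u n))%N.
  by elim: n => //= n IH; rewrite size_cat size_rcons addSn ltnS (leq_trans IH) ?leq_addl.
(* [u N] alone has length at least [N]; the leading [a] exceeds the bound. *)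
pose N := (\max_(p <- B) size (word p))%N.
have wN : walk (src (last a (u N))) (tgt a) (a :: u N).
  by rewrite /walk /= path_u !eqxx.
have [p pB [_ [_ wp]]] := walk_in_basis wN.
have : (size (word p) <= N)%N by move: (leqnn N) => /bigmax_leqP_seq; apply.
by rewrite wp /= ltnNge size_u.
Qed.

Lemma walk_uniq s t w : walk s t w -> uniq w.
Proof. by case/andP=> sw _; apply: sorted_uniq_acyclic sw => c; apply: acyclic_composable. Qed.

Lemma loop_rel a : src a = tgt a -> (a, a) \in R.
Proof.
move=> la; apply: contraT => raa; exfalso.
by apply: (@acyclic_composable [:: a]) => //=; rewrite /composable la eqxx raa.
Qed.

Lemma closed_walk_rel e b w : walk e e (b :: w) -> (last b w, b) \in R.
Proof.
case/and3P=> /= pw /eqP te /eqP se; apply: contraT => rlb; exfalso.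
by apply: (@acyclic_composable (b :: w)) => //=; rewrite rcons_path pw /composable rlb se te eqxx.
Qed.

Lemma walk_cons s t b w :
  walk s t (b :: w) = [&& tgt b == t, walk s (src b) w
                        & if w is a :: _ then (b, a) \notin R else true].
Proof.
case: w => [|a w] /=; rewrite /walk /=.
  by rewrite andbT [s == _]eq_sym.
rewrite /composable [tgt a == _]eq_sym; case: (src b == tgt a); case: (tgt b == t); rewrite ?andbF //=.
by case: ((b, a) \in R); case: (path _ a w); rewrite ?andbF ?andbT /=.
Qed.

Lemma walk_rcons s t w a :
  walk s t (rcons w a) = [&& src a == s, walk (tgt a) t w
                        & if w is b :: w' then (last b w', a) \notin R else true].
Proof.
case: w => [|b w] /=; rewrite /walk /=.
  by rewrite andbT andbC.
rewrite rcons_path last_rcons /composable.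
case: (path _ b w); case: (tgt b == t); case: (src a == s); case: (src _ == tgt a); rewrite ?andbF ?andbT //=.
Qed.

End Combinatorics.

(** * Spanning trees *)

Section Graph.
Variable Q : quiver.

Lemma adjacent_traversal (T : {set arr Q}) x y :
  adjacent T x y -> exists2 s, s.1 \in T & dstart s = x /\ dend s = y.
Proof.
case/existsP=> a /andP[aT /orP[]/andP[/eqP sa /eqP ta]].
  by exists (a, true).
by exists (a, false).
Qed.

(** No arrow is traversed twice: the second traversal, in either direction,
    would pass through the vertex at which the first one starts, and a simple
    path never returns there. *)
Lemma simple_path_traversal (T : {set arr Q}) x p :
  path (adjacent T) x p -> uniq (x :: p) ->
  exists w : seq (arr Q * bool),
   [/\ {subset map fst w <= T}, uniq (map fst w),
       map (@dstart Q) w = belast x p & map (@dend Q) w = p].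
Proof.
elim: p x => [|y p IH] x /=; first by exists [::].
case/andP=> /adjacent_traversal[s sT [sx sy]] /IH{}IH /andP[xNp uyp].
have [w [wT uw sw ew]] := IH uyp.
exists (s :: w); split=> /=.
- by move=> a /[!inE] /predU1P[-> //|/wT].
- rewrite uw andbT; apply/negP=> /mapP[t tw st].
  have bp z : z \in belast y p -> z \in y :: p by apply: mem_belast.
  have : dstart t \in y :: p by apply/bp; rewrite -sw map_f.
  have : dend t \in y :: p by rewrite inE -ew map_f ?orbT.
  suff : dstart s = dstart t \/ dstart s = dend t.
    by case=> <-; rewrite sx (negbTE xNp).
  rewrite /dstart /dend st; case: (s.2); case: (t.2); auto.
- by rewrite sw sx.
- by rewrite ew sy.
Qed.

(** The last traversal [s] is put in front of the walk that it closes, since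
    that is how the cycle through a prescribed arrow is written down. *)
Lemma traversal_cycle (s : arr Q * bool) w x p :
  map (@dstart Q) w = belast x p -> map (@dend Q) w = p -> dstart s = last x p ->
  dend s = x -> cycle (fun s t => dend s == dstart t) (s :: w).
Proof.
(* The first step and the closing step are separated, for the induction
   moves the former and keeps the latter. *)
move=> + + + + /=; move: {2 3}s => s0.
elim: w s0 x p => [|t w IH] s0 x [|y p] //=; first by move=> _ _ -> ->; rewrite eqxx.
by case=> -> sw [ty ew] sl ->; rewrite eqxx /=; apply: IH ew sl ty.
Qed.

(** A tree arrow is a bridge of the tree: a walk in the remaining tree arrows
    between its ends would close up to a cycle of the tree. *)
Lemma spanning_tree_bridge (T : {set arr Q}) a :
  spanning_tree T -> a \in T -> ~~ connect (adjacent (T :\ a)) (src a) (tgt a).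
Proof.
case=> _ acyc aT; apply/negP=> /connectP[p0 p0T eq_tgt].
case/shortenP: p0T eq_tgt => p pT up _ eq_tgt.
have [w [wT uw sw ew]] := simple_path_traversal pT up.
apply: (acyc ((a, false) :: w)).
  apply/and4P; split=> //=.
  - exact: (@traversal_cycle (a, false) w _ p sw ew eq_tgt erefl).
  - by rewrite uw andbT; apply/negP=> /wT; rewrite !inE eqxx.
  - by rewrite sw -rcons_uniq {1}/dstart /= eq_tgt -lastI.
by move=> b /[!inE] /predU1P[-> //|/wT /[!inE] /andP[]].
Qed.

Lemma connected_const (T : {set arr Q}) (A : eqType) (phi : vert Q -> A) :
  connected_by T -> (forall a, a \in T -> phi (src a) = phi (tgt a)) ->
  forall x y, phi x = phi y.
Proof.
move=> Tc phiT x y; have /connectP[p + ->] := Tc x y.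
elim: p x => //= z p IH x /andP[/existsP[a /andP[aT xz]] /IH <-].
by case/orP: xz => /andP[/eqP<- /eqP<-]; rewrite phiT.
Qed.

End Graph.

(** * Coefficient formulas for the differentials *)

Local Notation wd x := (word (snd_par x)).

Section ParallelPairs.
Variables (Q : quiver) (R : {set arr Q * arr Q}) (B : seq (qpath Q)).
Hypothesis hA : gentle R B.
Variables (X : finType) (sX tX : X -> vert Q).
Implicit Type x : par B sX tX.

Lemma par_raw x : raw (snd_par x) = (sX (fst_par x), wd x).
Proof. by case/andP: (valP x) => /eqP-> _; rewrite /snd_par /psrc /word -surjective_pairing. Qed.

Lemma par_walk x : walk R (sX (fst_par x)) (tX (fst_par x)) (wd x).
Proof.
rewrite walkE -par_raw -(gentle_basis hA); case/andP: (valP x) => _ /eqP tx.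
rewrite /snd_par ssvalP andbT; apply/andP; split; last by rewrite tx.
by have : is_path (raw (snd_par x)).1 (raw (snd_par x)).2 := valP (snd_par x); rewrite par_raw.
Qed.

(** A parallel pair is determined by its first component and its word, the
    source of the path being that of the first component. *)
Lemma par_inj x y : fst_par x = fst_par y -> wd x = wd y -> x = y.
Proof.
move=> e1 e2; apply/val_inj; apply/eqP; rewrite -pair_eqE /=; apply/andP.
split; first exact/eqP.
apply/eqP/val_inj/val_inj; rewrite -[LHS]/(raw (snd_par x)) -[RHS]/(raw (snd_par y)).
by rewrite !par_raw e1 e2.
Qed.

Lemma par_exists u w :
  walk R (sX u) (tX u) w -> {x : par B sX tX | fst_par x = u & wd x = w}.
Proof.
move=> /(walk_in_basis hA)[p pB [sp [tp wp]]].
have ux : (sX (u, SeqSub pB).1 == psrc (val (u, SeqSub pB).2))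
       && (tX (u, SeqSub pB).1 == ptgt (val (u, SeqSub pB).2)).
  by rewrite /= sp tp !eqxx.
by exists (exist _ (u, SeqSub pB) ux).
Qed.

Lemma sum_par (V : nmodType) x (F : par B sX tX -> V) P :
  P =1 (fun y => (fst_par y == fst_par x) && (wd y == wd x)) ->
  \sum_(y | P y) F y = F x.
Proof.
move=> Px; apply: big_pred1 => y; rewrite Px /=; apply/andP/eqP=> [[/eqP e1 /eqP]|->//].
exact: par_inj.
Qed.

End ParallelPairs.

Lemma sum_delta (K : pzSemiRingType) (I : finType) (P C : pred I) (b : I) :
  \sum_(a | P a) ((b == a) && C a)%:R = (P b && C b)%:R :> K.
Proof.
rewrite big_mkcond (bigD1 b) //= eqxx big1 ?addr0; first by case: (P b).
by move=> a /negbTE ab; rewrite eq_sym ab; case: (P a).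
Qed.

Section Differentials.
Variables (K : fieldType) (Q : quiver) (R : {set arr Q * arr Q}).
Variable B : seq (qpath Q).
Hypothesis hA : gentle R B.

(** The coefficient of [(a, q)] in [d0 h] sees at most two coordinates of [h]:
    the path obtained from [q] by deleting an initial or a final [a]. *)
Lemma d0E (h : C0 K B) (z : par1 B) :
  d0 K B h z =
    \sum_(x | (fst_par x == src (fst_par z)) && (wd z == fst_par z :: wd x)) h x
  - \sum_(x | (fst_par x == tgt (fst_par z)) && (wd z == rcons (wd x) (fst_par z))) h x.
Proof.
rewrite lfunE /= /lin_ext sum_ffunE !(big_mkcond (fun _ => _ && _)) -sumrB.
apply: eq_bigr => x _; rewrite !ffunE !sum_ffunE.
under eq_bigr do rewrite ffunE par_raw.
under [X in _ - X]eq_bigr do rewrite ffunE par_raw.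
rewrite !(sum_delta _ _ (fun a => _ == _)) {1}/psrc par_raw /= !xpair_eqE eqxx.
rewrite ![_ == fst_par x]eq_sym andbA andbb /= /GRing.scale /= mulrBr !mulr_natr.
by do 2!case: (_ && _).
Qed.

(** Dually, the coefficient of [(ba, q)] in [d1 f] comes from deleting [b] at
    the end of [q], or [a] at its beginning. *)
Lemma d1E (f : C1 K B) (z : par2 R B) :
  let r := val (fst_par z) in
  d1 K R B f z =
    \sum_(x | (fst_par x == r.2) && (wd z == r.1 :: wd x)) f x
  + \sum_(x | (fst_par x == r.1) && (wd z == rcons (wd x) r.2)) f x.
Proof.
move=> r; rewrite lfunE /= /lin_ext sum_ffunE !(big_mkcond (fun _ => _ && _)) -big_split.
apply: eq_bigr => x _; rewrite !ffunE !sum_ffunE.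
rewrite (bigD1 (fst_par z)) //= [X in _ + X]big1 ?addr0; last first.
  move=> s /negbTE sz; rewrite sum_ffunE big1 // => i _.
  by rewrite ffunE eq_sym sz.
rewrite sum_ffunE big_mkcond big_ord_recl big_ord1 /= !ffunE eqxx par_raw !xpair_eqE !eqxx /=.
rewrite -/r cats0 cats1 ![_ == fst_par x]eq_sym addrC /GRing.scale /= mulrDr.
by do 2!case: (fst_par x == _) => /=; do ?case: (_ == _); rewrite ?mulr0 ?mulr1.
Qed.

End Differentials.

Section FreeSpaceFacts.
Variables (K : fieldType) (I : finType).

Lemma sum_basis_vec (P : pred I) x :
  \sum_(y | P y) basis_vec K x y = (P x)%:R.
Proof.
under eq_bigr do rewrite ffunE eq_sym -[x == _]andbT.
by rewrite (sum_delta _ _ xpredT) andbT.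
Qed.

Lemma basis_vec_decomp (f : {ffun I -> K^o}) : f = \sum_x f x *: basis_vec K x.
Proof.
apply/ffunP => y; rewrite sum_ffunE (bigD1 y) //= big1 => [|x /negbTE xy].
  by rewrite !ffunE eqxx addr0 /GRing.scale /= mulr1.
by rewrite !ffunE eq_sym xy scaler0.
Qed.

Lemma free_family (V : vectType K) (A : {set I}) (b : I -> V) :
  (forall k : I -> K, \sum_(i in A) k i *: b i = 0 -> forall i, i \in A -> k i = 0) ->
  free [seq b i | i <- enum A].
Proof.
move=> bA; rewrite -[[seq _ | _ <- _]]/(tval (map_tuple b (enum_tuple A))).
apply/freeP => k.
case: (set_0Vmem A) => [A0|[i0 Ai0]].
  by move=> _ [m mA]; exfalso; rewrite A0 cards0 in mA.
under eq_bigr => j _ do rewrite (nth_map i0) -?cardE // -enum_val_nth.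
move=> k0 j; rewrite -[j](enum_valK_in Ai0).
have /bA : \sum_(i in A) k (enum_rank_in Ai0 i) *: b i = 0.
  rewrite big_enum_val /= -[RHS]k0; apply: eq_bigr => m _.
  by rewrite enum_valK_in.
by apply; apply: enum_valP.
Qed.

End FreeSpaceFacts.

(** * Coboundaries and cocycles *)

Section Cocycles.
Variables (K : fieldType) (Q : quiver) (R : {set arr Q * arr Q}).
Variable B : seq (qpath Q).
Hypothesis hA : gentle R B.
Implicit Types (f g : C1 K B) (h : C0 K B) (x z : par1 B).

Lemma sum_par0 (X : finType) (sX tX : X -> vert Q) (F : par B sX tX -> K)
    (P : pred (par B sX tX)) :
  (forall y, P y -> False) -> \sum_(y | P y) F y = 0.
Proof. by move=> P0; apply: big_pred0 => y; apply/negP; apply: P0. Qed.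

Lemma word_headN z w : wd z = fst_par z :: w -> fst_par z \notin w.
Proof. by move=> wz; have := walk_uniq hA (par_walk hA z); rewrite wz => /andP[]. Qed.

Lemma word_lastN z w : wd z = rcons w (fst_par z) -> fst_par z \notin w.
Proof. by move=> wz; have := walk_uniq hA (par_walk hA z); rewrite wz rcons_uniq => /andP[]. Qed.

(** Both halves of the coefficient at [(ba, q)] see only the closed paths [u]
    with [q = bua], with opposite signs: the other terms would need [ba] to
    be a subpath of [q]. *)
Lemma d1_d0 h : d1 K R B (d0 K B h) = 0.
Proof.
apply/ffunP => z; rewrite d1E ffunE; set r := val _.
have rR : r \in R by apply: valP.
have r12 := gentle_rel_path hA rR.
have wz : walk R (src r.2) (tgt r.1) (wd z) := par_walk hA z.
transitivity (- \sum_(y | (fst_par y == tgt r.2) && (wd z == r.1 :: rcons (wd y) r.2)) h y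
  + \sum_(y | (fst_par y == src r.1) && (wd z == r.1 :: rcons (wd y) r.2)) h y);
  last by rewrite r12 addNr.
congr (_ + _).
  case: (wd z) wz => [|b w].
    by rewrite !sum_par0 ?oppr0 // => y; rewrite andbF.
  rewrite walk_cons => /and3P[tb ww bw].
  have [rb|rb] := eqVneq b r.1; last first.
    by rewrite !sum_par0 ?oppr0 // => y; rewrite eqseq_cons (negbTE rb) andbF.
  rewrite rb r12 in ww.
  have [x fx wx] := par_exists hA (sX := @src Q) (tX := @tgt Q) ww.
  rewrite (sum_par (x := x)); last first.
    by move=> y; rewrite fx wx rb eqseq_cons eqxx /= [w == _]eq_sym.
  rewrite d0E fx wx rb [X in X - _]sum_par0 ?sub0r.
    by congr (- _); apply: eq_bigl => y; rewrite eqseq_cons eqxx.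
  move=> y /andP[_ /eqP wr]; move: bw; rewrite rb wr.
  by rewrite -surjective_pairing rR.
case/lastP: (wd z) wz => [|w b].
  by rewrite !sum_par0 // => y /andP[_]; rewrite ?(eqP (esym _)) //; case: (wd y).
rewrite walk_rcons => /and3P[tb ww bw].
have [rb|rb] := eqVneq b r.2; last first.
  by rewrite !sum_par0 // => y; rewrite -?rcons_cons eqseq_rcons (negbTE rb) !andbF.
rewrite rb -r12 in ww.
have [x fx wx] := par_exists hA (sX := @src Q) (tX := @tgt Q) ww.
rewrite (sum_par (x := x)); last first.
  by move=> y; rewrite fx wx rb eqseq_rcons eqxx andbT [w == _]eq_sym.
rewrite d0E fx wx rb [X in _ - X]sum_par0 ?subr0.
  by apply: eq_bigl => y; rewrite -rcons_cons eqseq_rcons eqxx andbT.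
move=> y /andP[_ /eqP wr]; move: bw; rewrite rb wr.
by case: (wd y) => [|c v] /=; rewrite ?last_rcons -surjective_pairing rR.
Qed.

(** With [q = aw], the closed path [w] satisfies [d0 (src a, w) = (a, aw)]: a
    second term [(y, wy)] would require an arrow [y] ending where [a] starts.
    As [a] is on the left of no relation, both [y] and the last arrow of [w]
    can then precede [a], so they are equal; but [wy] is nonzero, whereas [ww]
    vanishes because [w] is closed. *)
Lemma head_coboundary z w :
  wd z = fst_par z :: w -> w != [::] -> (forall c, (fst_par z, c) \notin R) ->
  exists h, d0 K B h = basis_vec K z.
Proof.
move=> wz wn0 aR; have := par_walk hA z; rewrite wz walk_cons => /and3P[_ ww _].
have [u fu wu] := par_exists hA (sX := id) (tX := id) ww.
exists (basis_vec K u); apply/ffunP => y; rewrite d0E !sum_basis_vec ffunE fu wu.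
case: w wn0 wz ww {wu} => // b w _ wz ww.
have rlb := closed_walk_rel hA ww.
have /andP[/eqP tb _] : (tgt b == src (fst_par z)) && true.
  by case/and3P: ww => _ ->.
have zb : composable R (fst_par z) b by rewrite /composable tb eqxx aR.
rewrite [in X in _ - X](_ : _ && _ = false) ?subr0.
  congr (_%:R); congr (nat_of_bool _); apply/andP/eqP => [[/eqP sy /eqP wy]|->]; last first.
    by rewrite wz !eqxx.
  have yb : composable R (fst_par y) b.
    rewrite /composable tb sy eqxx /=.
    by have := par_walk hA y; rewrite wy walk_cons => /and3P[].
  have yz := composable_afterI hA yb zb.
  by apply: par_inj => //; rewrite wy wz yz.
apply/negP => /andP[/eqP ty /eqP wy].
have zy : composable R (fst_par z) (fst_par y) by rewrite /composable ty eqxx aR.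
have := par_walk hA y; rewrite wy walk_rcons => /and3P[_ _].
by rewrite (composable_beforeI hA zy zb) rlb.
Qed.

(** For a closed path [u] at most one arrow [y] has [uy] nonzero, so [(y, uy)]
    is the only pair of this shape in [d0 (tgt y, u)], with coefficient [-1].
    A suitable combination of these coboundaries therefore clears all
    coordinates of this shape at once. *)
Lemma clear_last f :
  exists h, forall z w, wd z = rcons w (fst_par z) -> w != [::] ->
    (f + d0 K B h) z = 0.
Proof.
pose h : C0 K B := [ffun y => if wd y == [::] then 0 else
  \sum_(z | (tgt (fst_par z) == fst_par y) && (wd z == rcons (wd y) (fst_par z))) f z].
exists h => z w wz wn0; rewrite ffunE d0E.
rewrite [in X in _ + (X - _)]sum_par0 ?sub0r; last first.
  move=> y /andP[_ /eqP wy]; have /negP := word_lastN wz; apply.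
  by case: w wn0 wz => // b w _; rewrite wy => -[->]; rewrite mem_head.
have := par_walk hA z; rewrite wz walk_rcons => /and3P[_ ww lw].
have [u fu wu] := par_exists hA (sX := id) (tX := id) ww.
rewrite (sum_par (x := u)); last first.
  by move=> y; rewrite fu wu eqseq_rcons eqxx andbT [w == _]eq_sym.
(* It remains to see that the sum defining [h u] has the single term [f z]. *)
rewrite ffunE wu (negbTE wn0) (sum_par (x := z)) ?subrr // => y.
apply/andP/andP => -[/eqP fy /eqP wy]; last by rewrite fy wy fu wz !eqxx.
suff yz : fst_par y = fst_par z by rewrite wy yz wz.
have := par_walk hA y; rewrite wy walk_rcons => /and3P[_ _].
case: w wn0 ww lw {wz wu wy} => // b w _ /and3P[_ _ /eqP sw] lz ly.
by apply: (@composable_beforeI _ _ _ hA (last b w)); rewrite /composable ?fy ?fu sw eqxx ?ly ?lz.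
Qed.

(** On the pairs [(a, a)] the complex is the cochain complex of the graph: every
    vertex function has its coboundary in the image of [d0], and
    [d0_diagonal] says that nothing else occurs there. *)
Lemma diagonal_d0 (phi : vert Q -> K) :
  exists h, forall z, d0 K B h z =
    if wd z == [:: fst_par z] then phi (src (fst_par z)) - phi (tgt (fst_par z)) else 0.
Proof.
pose h : C0 K B := [ffun y => if wd y == [::] then phi (fst_par y) else 0].
exists h => z; rewrite d0E.
case: eqP => [wz|/eqP wz].
  have wk v : walk R v v [::] by rewrite /walk /= eqxx.
  have [u fu wu] := par_exists hA (sX := id) (tX := id) (wk (src (fst_par z))).
  have [v fv wv] := par_exists hA (sX := id) (tX := id) (wk (tgt (fst_par z))).
  rewrite (sum_par (x := u)) => [|y]; last first.
    by rewrite fu wu wz eqseq_cons eqxx [_ == wd y]eq_sym.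
  rewrite (sum_par (x := v)) => [|y]; last first.
    by rewrite fv wv wz (eqseq_rcons [::]) eqxx andbT [_ == wd y]eq_sym.
  by rewrite !ffunE wu wv fu fv eqxx.
rewrite !big1 ?subr0 // => y /andP[_ /eqP wy]; rewrite ffunE; case: eqP => // wy0;
  by rewrite wy wy0 eqxx in wz.
Qed.

Lemma d0_nil h z : wd z = [::] -> d0 K B h z = 0.
Proof.
by move=> wz; rewrite d0E !sum_par0 ?subr0 // => y; rewrite wz; case: (wd y) => [|??]; rewrite andbF.
Qed.

Lemma d0_diagonal h : exists phi : vert Q -> K, forall z,
  wd z = [:: fst_par z] -> d0 K B h z = phi (src (fst_par z)) - phi (tgt (fst_par z)).
Proof.
exists (fun v => \sum_(y | (fst_par y == v) && (wd y == [::])) h y) => z wz.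
rewrite d0E wz; congr (_ - _); apply: eq_bigl => y.
  by rewrite eqseq_cons eqxx [_ == wd y]eq_sym.
by rewrite (eqseq_rcons [::]) eqxx andbT [_ == wd y]eq_sym.
Qed.

Lemma in_relationPn a : ~~ in_relation R a -> forall r, r \in R -> (r.1 != a) * (r.2 != a).
Proof.
move=> /negP aR r rR; split; apply/negP => ra; apply: aR; apply/existsP; exists r;
  by rewrite rR ra ?orbT.
Qed.

(** * The family in the kernel *)

Variable S : {set arr Q}.
Let X := hh1_family K R B S.

(** Shortcuts and deviations behave alike in what follows: what matters is only
    that the arrow is in no relation and is neither the first nor the last
    arrow of the path. *)
Variant family_spec x : Prop :=
 | FamilyInner of ~~ in_relation R (fst_par x)
     & (forall w, wd x != fst_par x :: w) & (forall w, wd x != rcons w (fst_par x))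
 | FamilyDiagonal of wd x = [:: fst_par x] & fst_par x \in S
 | FamilyLoop of wd x = [::] & 2%N \in [pchar K].

Lemma hh1_familyP x : x \in X -> family_spec x.
Proof.
rewrite !inE -!orbA => /or4P[/andP[ax aR]|/andP[/existsP[i /and3P[/eqP ix i0 im]] aR]|/andP[xS /eqP wx]|].
- apply: FamilyInner => // w; apply/eqP => wx; move: ax; rewrite wx.
    by rewrite mem_head.
  by rewrite mem_rcons mem_head.
- apply: FamilyInner => // w; apply/eqP => wx.
    have /negP := word_headN wx; apply.
    move: i ix i0 im; rewrite wx => -[[|i] //= im] <- _ _.
    exact: mem_nth.
  have /negP := word_lastN wx; apply.
  move: i ix i0 im; rewrite wx size_rcons => i; rewrite nth_rcons => + _ iw.
  by rewrite ltnS in iw; rewrite iw => <-; apply: mem_nth.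
- exact: FamilyDiagonal.
- by case: ifP => // ch; rewrite ?inE // => /eqP wx; apply: FamilyLoop.
Qed.

(** For a pair [(a, s(a))] the relation [(a, a)] is hit twice, once for each
    occurrence of [a], which gives zero in characteristic two. *)
Lemma family_ker x : x \in X -> basis_vec K x \in ker_d1 K R B.
Proof.
move=> xX; rewrite memv_ker; apply/eqP/ffunP => z; rewrite d1E ffunE !sum_basis_vec.
set r := val _; have rR : r \in R by apply: valP.
have wz : walk R (src r.2) (tgt r.1) (wd z) := par_walk hA z.
case: (hh1_familyP xX) => [aR _ _|wx _|wx ch2].
- have [/negbTE r1 /negbTE r2] := in_relationPn aR rR.
  by rewrite ![fst_par x == _]eq_sym r1 r2 addr0.
- have nwz b c : wd z = [:: b; c] -> b = r.1 -> c = r.2 -> False.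
    move=> wE bE cE; move: wz; rewrite wE walk_cons => /and3P[_ _].
    by rewrite bE cE -surjective_pairing rR.
  rewrite wx /=; suff [-> ->] :
      ((fst_par x == r.2) && (wd z == [:: r.1; fst_par x]) = false)
   /\ ((fst_par x == r.1) && (wd z == [:: fst_par x; r.2]) = false).
    by rewrite addr0.
  by split; apply/negP => /andP[/eqP xr /eqP wE]; have := nwz _ _ wE; rewrite xr; apply.
rewrite wx /=.
have lx : (fst_par x, fst_par x) \in R.
  apply: (loop_rel hA).
  by have := par_walk hA x; rewrite wx /walk => /eqP.
rewrite [in X in _ + X](_ : (_ && _) = (fst_par x == r.2) && (wd z == [:: r.1])).
  by rewrite (addrr_pchar2 ch2).
case: r rR wz => b a /= rR wz.
apply/andP/andP => -[/eqP xr wE]; rewrite xr in lx.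
  have ba := rel_beforeI hA lx rR; rewrite -ba in wE *; by rewrite xr eqxx wE.
have ab := rel_afterI hA lx rR; rewrite -ab in wE *; by rewrite xr eqxx wE.
Qed.

End Cocycles.

(** * Spanning and independence modulo coboundaries *)

Section Basis.
Variables (K : fieldType) (Q : quiver) (R : {set arr Q * arr Q}).
Variable B : seq (qpath Q).
Hypothesis hA : gentle R B.
Implicit Types (f g : C1 K B) (h : C0 K B) (x z : par1 B).
Variable S : {set arr Q}.
Hypothesis hS : spanning_tree (~: S).
Let X := hh1_family K R B S.
Let U := (limg (d0 K B) + <<[seq basis_vec K x | x <- enum X]>>)%VS.

Lemma family_span x : x \in X -> basis_vec K x \in U.
Proof.
move=> xX; apply: (subvP (addvSr _ _)); apply: memv_span.
by apply: map_f; rewrite mem_enum.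
Qed.

Lemma coboundary_span h : d0 K B h \in U.
Proof. by apply: (subvP (addvSl _ _)); apply: memv_img; apply: memvf. Qed.

(** For a tree arrow [a], the coboundary of the indicator function of one side
    of the cut that [a] defines in the tree is [(a, a)] plus a combination of
    pairs [(b, b)] with [b] in [S]. *)
Lemma diagonal_span z : wd z = [:: fst_par z] -> basis_vec K z \in U.
Proof.
move=> wz; have [zS|zS] := boolP (fst_par z \in S).
  by apply: family_span; rewrite !inE zS wz eqxx !orbT.
pose phi v : K := (connect (adjacent (~: S :\ fst_par z)) (src (fst_par z)) v)%:R.
have [h hE] := diagonal_d0 hA phi.
have hz : d0 K B h z = 1.
  rewrite hE wz eqxx /phi connect0.
  by rewrite (negbTE (spanning_tree_bridge hS _)) ?subr0 // inE.
have -> : basis_vec K z = d0 K B h - \sum_(y | y != z) d0 K B h y *: basis_vec K y.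
  by rewrite {1}[d0 K B h]basis_vec_decomp (bigD1 z) //= addrK hz scale1r.
rewrite rpredB ?coboundary_span // memv_suml // => y yz.
rewrite hE; case: eqP => wy; last by rewrite scale0r mem0v.
have [yS|yS] := boolP (fst_par y \in S).
  by apply/memvZ/family_span; rewrite !inE yS wy eqxx !orbT.
suff -> : phi (src (fst_par y)) = phi (tgt (fst_par y)).
  by rewrite subrr scale0r mem0v.
have yT : fst_par y \in ~: S :\ fst_par z.
  rewrite !inE yS andbT; apply: contra yz => /eqP yz; apply/eqP.
  by apply: par_inj; rewrite // wz wy yz.
have adj : adjacent (~: S :\ fst_par z) (src (fst_par y)) (tgt (fst_par y)).
  by apply/existsP; exists (fst_par y); rewrite yT !eqxx.
have jda : adjacent (~: S :\ fst_par z) (tgt (fst_par y)) (src (fst_par y)).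
  by apply/existsP; exists (fst_par y); rewrite yT !eqxx orbT.
congr (_%:R); congr (nat_of_bool _); apply/idP/idP => c; apply: (connect_trans c);
  exact: connect1.
Qed.

Lemma rel_par_exists r w : r \in R -> walk R (src r.2) (tgt r.1) w ->
  {y : par2 R B | val (fst_par y) = r & wd y = w}.
Proof.
move=> rR rw; have [y fy wy] := par_exists hA (u := exist _ r rR)
  (sX := fun r : rel_path R => src (val r).2)
  (tX := fun r : rel_path R => tgt (val r).1) rw.
by exists y => //; rewrite fy.
Qed.

(** The relation [(a, a)] of a loop [a] gives the coefficient [2 * g z] of
    [d1 g] at [(aa, a)]. *)
Lemma kernel_trivial_char2 g z :
  d1 K R B g = 0 -> wd z = [::] -> g z != 0 -> 2%N \in [pchar K].
Proof.
move=> g0 wz gz; set a := fst_par z.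
have la : src a = tgt a by have := par_walk hA z; rewrite wz /walk => /eqP.
have aR := loop_rel hA la.
have wa : walk R (src (a, a).2) (tgt (a, a).1) [:: a] by rewrite /walk /= !eqxx.
have [y fy wy] := rel_par_exists aR wa.
have := congr1 (fun k : C2 K R B => k y) g0; rewrite d1E ffunE fy wy /=.
rewrite (sum_par (x := z)) => [|y']; last first.
  by rewrite wz eqseq_cons eqxx [_ == wd y']eq_sym.
rewrite (sum_par (x := z)) => [|y']; last first.
  by rewrite wz (eqseq_rcons [::]) eqxx andbT [_ == wd y']eq_sym.
move/eqP; rewrite -mulr2n -mulr_natr mulf_eq0 (negbTE gz) /= => two0.
by rewrite inE two0.
Qed.

(** If [ac] is a relation, the coefficient of [d1 g] at [(ac, pc)] is the
    coordinate of [g] at [(a, p)], up to the coordinate at [(c, uc)] when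
    [p = au]; the normalisation makes the latter vanish. *)
Lemma kernel_no_rel_before g z :
  d1 K R B g = 0 ->
  (forall x w, wd x = rcons w (fst_par x) -> w != [::] -> g x = 0) ->
  wd z != [::] -> (forall w, wd z != rcons w (fst_par z)) -> g z != 0 ->
  forall c, (fst_par z, c) \notin R.
Proof.
set a := fst_par z => g0 gE wn0 lastN gz c.
apply/negP => ac; move/eqP: gz; apply.
have tc := gentle_rel_path hA ac.
have wr : walk R (src (a, c).2) (tgt (a, c).1) (rcons (wd z) c).
  rewrite walk_rcons eqxx -tc par_walk //=.
  case wE: (wd z) wn0 => [//|b w] _; apply/negP => lc.
  have := lastN (belast b w).
  by rewrite wE lastI (rel_afterI hA lc ac) eqxx.
have [y fy wy] := rel_par_exists ac wr.
have := congr1 (fun k : C2 K R B => k y) g0; rewrite d1E ffunE fy wy /=.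
rewrite big1 ?add0r => [|x /andP[/eqP fx /eqP wE]]; last first.
  case: (wd z) wn0 lastN wE => // b w _ lastN [ba wx]; apply: (gE x w).
    by rewrite fx wx.
  by apply/eqP => w0; have := lastN [::]; rewrite ba w0 eqxx.
rewrite (sum_par (x := z)) // => y'.
by rewrite eqseq_rcons eqxx andbT [wd z == _]eq_sym.
Qed.

(** Symmetrically for a relation [ba], read off at [(ba, bp)]; as [p] does not
    start with [a], no other coordinate of [g] contributes. *)
Lemma kernel_no_rel_after g z :
  d1 K R B g = 0 -> wd z != [::] -> (forall w, wd z != fst_par z :: w) ->
  (forall w, wd z != rcons w (fst_par z)) -> g z != 0 ->
  forall b, (b, fst_par z) \notin R.
Proof.
set a := fst_par z => g0 wn0 headN lastN gz b.
apply/negP => ba; move/eqP: gz; apply.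
have tb := gentle_rel_path hA ba.
have wr : walk R (src (b, a).2) (tgt (b, a).1) (b :: wd z).
  rewrite walk_cons eqxx /= [src b]tb par_walk //=.
  case wE: (wd z) headN => [//|d w] /= dN; apply/negP => bd.
  by have := dN w; rewrite (rel_beforeI hA bd ba) eqxx.
have [y fy wy] := rel_par_exists ba wr.
have := congr1 (fun k : C2 K R B => k y) g0; rewrite d1E ffunE fy wy /=.
rewrite [X in _ + X]big1 ?addr0 => [|x /andP[_ /eqP wE]]; last first.
  exfalso; case/lastP: (wd z) wn0 lastN wE => // w d _ dN.
  by rewrite -rcons_cons => /rcons_inj[_ da]; have := dN w; rewrite da eqxx.
rewrite (sum_par (x := z)) // => y'.
by rewrite eqseq_cons eqxx [wd z == _]eq_sym.
Qed.

Lemma inner_family z :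
  ~~ in_relation R (fst_par z) -> (forall w, wd z != fst_par z :: w) ->
  (forall w, wd z != rcons w (fst_par z)) -> z \in X.
Proof.
set a := fst_par z => aR headN lastN.
rewrite !inE -/a aR !andbT; have [az|//] := boolP (a \in wd z).
apply/orP; left; apply/orP; left; apply/orP; right.
have iz : (index a (wd z) < size (wd z))%N by rewrite index_mem.
apply/existsP; exists (Ordinal iz); rewrite /= nth_index // eqxx /=.
apply/andP; split.
  case: (wd z) az headN {iz} => [|b w] //= _ bN.
  by have [ba|//] := eqVneq b a; have := bN w; rewrite ba eqxx.
rewrite ltn_neqAle iz andbT; apply/eqP => sz.
have := lastN (take (index a (wd z)) (wd z)).
by rewrite -{1}[wd z](take_size) -sz (take_nth a) ?index_mem // nth_index // eqxx.
Qed.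

(** After normalisation every pair [(a, p)] in the support of a cocycle is of
    one of four kinds: [p] trivial in characteristic two, [p = a], [p = aw]
    with no relation [ac], so that the pair is a coboundary, or a shortcut or
    deviation. *)
Lemma kernel_span f : f \in ker_d1 K R B -> f \in U.
Proof.
rewrite memv_ker => /eqP f0; have [h hE] := clear_last hA f.
set g := f + d0 K B h in hE.
have g0 : d1 K R B g = 0 by rewrite linearD /= f0 d1_d0 // addr0.
have -> : f = g - d0 K B h by rewrite addrK.
rewrite rpredB ?coboundary_span // [g]basis_vec_decomp memv_suml // => z _.
have [-> |gz] := eqVneq (g z) 0; first by rewrite scale0r mem0v.
apply: memvZ; set a := fst_par z.
have [wz|wn0] := eqVneq (wd z) [::].
  apply: family_span; have ch2 := kernel_trivial_char2 g0 wz gz.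
  by rewrite /X /hh1_family ch2 !inE wz eqxx !orbT.
have [wz|wz] := eqVneq (wd z) [:: a]; first exact: diagonal_span.
have lastN w : wd z != rcons w a.
  apply/eqP => wE; move/eqP: gz; apply; apply: hE (wE) _.
  by apply/eqP => w0; move: wz; rewrite wE w0 eqxx.
have aRN := kernel_no_rel_before g0 hE wn0 lastN gz.
have [/eqP|headN] := eqVneq (ohead (wd z)) (Some a).
  case wE: (wd z) wz => [//|b w] wz /eqP[ba].
  rewrite ba in wE wz.
  have [|h' <-] := head_coboundary K hA wE _ aRN; last exact: coboundary_span.
  by apply/eqP => w0; rewrite w0 eqxx in wz.
have {}headN w : wd z != a :: w by apply: contra headN => /eqP->.
have RaN := kernel_no_rel_after g0 wn0 headN lastN gz.
apply/family_span/inner_family => //.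
apply/existsP => -[[b c] /andP[rR /orP[/eqP /= bE|/eqP /= cE]]].
  by have := aRN c; rewrite -bE rR.
by have := RaN b; rewrite -cE rR.
Qed.

(** Only the diagonal part of the family can meet the coboundaries, and there a
    combination supported on [S] is the coboundary of a vertex function that
    is constant along the spanning tree [~: S]. *)
Lemma family_free (k : par1 B -> K) :
  \sum_(x in X) k x *: basis_vec K x \in limg (d0 K B) ->
  forall x, x \in X -> k x = 0.
Proof.
set f := \sum_(x in X) _ => /memv_imgP[h _ fh].
have fX x : x \in X -> k x = d0 K B h x.
  move=> xX; rewrite -fh /f sum_ffunE (bigD1 x) //= big1 => [|y /andP[_ /negbTE yx]].
    by rewrite !ffunE eqxx addr0 /GRing.scale /= mulr1.
  by rewrite !ffunE eq_sym yx scaler0.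
have [phi phiE] := d0_diagonal h.
have phi_const : forall u v, phi u = phi v.
  apply: (connected_const hS.1) => a; rewrite inE => aS.
  have wa : walk R (src a) (tgt a) [:: a] by rewrite /walk /= !eqxx.
  have [z fz wz] := par_exists hA (sX := @src Q) (tX := @tgt Q) wa.
  apply/eqP; rewrite -subr_eq0 -fz -phiE ?fz // -fh /f sum_ffunE big1 // => x xX.
  rewrite !ffunE; case: eqP => [zx|_]; last by rewrite scaler0.
  rewrite -zx in xX; case: (hh1_familyP hA xX) => [_ /(_ [::])|_|].
  - by rewrite wz fz eqxx.
  - by rewrite fz (negbTE aS).
  - by rewrite wz.
move=> x xX; rewrite fX //; case: (hh1_familyP hA xX) => [_ hN lN|wx _|wx _].
- rewrite d0E !sum_par0 ?subr0 // => y /andP[_].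
    by rewrite (negbTE (lN _)).
  by rewrite (negbTE (hN _)).
- by rewrite phiE // (phi_const _ (tgt (fst_par x))) subrr.
- exact: d0_nil.
Qed.

Lemma hh1_class_eq0 f : f \in ker_d1 K R B ->
  (hh1_class R f == 0) = (f \in limg (d0 K B)).
Proof.
by move=> fk; rewrite /hh1_class vquot_pi_eq0 -memv_preim lfunE /= vsprojK.
Qed.

Lemma limg_d0_ker : (limg (d0 K B) <= ker_d1 K R B)%VS.
Proof. by apply/subvP => _ /memv_imgP[h _ ->]; rewrite memv_ker d1_d0. Qed.

Lemma family_basis :
  basis_of {: HH1 K R B} [seq hh1_class R (basis_vec K x) | x <- enum X].
Proof.
(* [hh1_class] as a bundled linear map. *)
pose F := (linfun (vquot_pi (im_d0 K R B)) \o linfun (vsproj (ker_d1 K R B)))%VF.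
have FE f : F f = hh1_class R f by rewrite comp_lfunE !lfunE.
apply/andP; split; last first.
  apply: free_family => k k0; apply: family_free.
  rewrite -hh1_class_eq0; last by apply: memv_suml => x xX; apply/memvZ/(family_ker hA (S := S)).
  rewrite -FE linear_sum /= -[X in _ == X]k0; apply/eqP; apply: eq_bigr => x _.
  by rewrite linearZ /= FE.
rewrite eqEsubv subvf; apply/subvP => v _.
pose f : C1 K B := vsval (vquot_repr v).
have -> : v = F f by rewrite FE /hh1_class vsvalK vquot_reprK.
have /memv_addP[u ud [s sX fE]] := kernel_span (subvsP (vquot_repr v)).
have /eqP Fu : F u == 0 by rewrite FE hh1_class_eq0 // (subvP limg_d0_ker).
rewrite [f]fE linearD /= Fu add0r (eq_map (fun x => esym (FE (basis_vec K x)))).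
by rewrite (map_comp F) -limg_span memv_img.
Qed.

End Basis.

Unset Implicit Arguments.

Theorem theorem3p4 (K : fieldType) (Q : quiver) (R : {set arr Q * arr Q})
    (B : seq (qpath Q)) (hA : gentle R B)
    (hK : ~ is_base_field Q) (hD : ~ is_dual_numbers Q)
    (T : {set arr Q}) (hT : spanning_tree T)
    (c : arr Q -> arr Q) (hc : fundamental_choice T c) :
  let X := hh1_family K R B (chosen_arrows T c) in
  (forall x, x \in X -> basis_vec K x \in ker_d1 K R B)
  /\ basis_of {: HH1 K R B} [seq hh1_class R (basis_vec K x) | x <- enum X].
Proof.
split=> [x|]; first exact: family_ker.
by case: hc => _ hS; apply: (family_basis K hA hS).
Qed.
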